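(* Let $q$ be a prime power and $\nu\ge 1$ an integer. The chromatic number of the symplectic graph $Sp(2\nu,q)$ is $$\chi(Sp(2\nu,q))=q^{\nu}+1.$$
   Context: Let $\mathbb{F}_q$ be the finite field with $q$ elements (any characteristic), and let $\mathbb{F}_q^{(2\nu)}$ be the $2\nu$-dimensional space of row vectors over $\mathbb{F}_q$. Let $K$ be the $2\nu\times 2\nu$ block diagonal matrix over $\mathbb{F}_q$ with $\nu$ diagonal blocks all equal to $\begin{pmatrix}0&1\\-1&0\end{pmatrix}$. For a nonzero row vector $\alpha$, $[\alpha]$ denotes the one-dimensional subspace spanned by $\alpha$. The symplectic graph $Sp(2\nu,q)$ is the simple undirected graph whose vertices are the one-dimensional subspaces of $\mathbb{F}_q^{(2\nu)}$, with $[\alpha]$ adjacent to $[\beta]$ if and only if $\alpha K\,{}^t\!\beta\neq 0$ (where ${}^t\!\beta$ is the transpose of $\beta$). *)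

(* Defs.v *)
From HB Require Import structures.
From mathcomp Require Import all_boot all_order all_algebra.

Set Implicit Arguments.
Unset Strict Implicit.
Unset Printing Implicit Defensive.

Import GRing.Theory.

Local Open Scope ring_scope.

Record sgraph := SGraph {
  vertex : finType;
  adj : rel vertex;
  adj_sym : symmetric adj;
  adj_irr : irreflexive adj
}.

Definition proper_coloring (G : sgraph) (k : nat)
    (c : {ffun vertex G -> 'I_k}) : bool :=
  [forall x, forall y, adj x y ==> (c x != c y)].

Definition colorable (G : sgraph) : pred nat :=
  fun k => [exists c : {ffun vertex G -> 'I_k}, proper_coloring c].

Lemma colorable_exists (G : sgraph) : exists k, colorable G k.
Proof.
exists #|vertex G|; apply/existsP; exists [ffun x => enum_rank x].
apply/forallP=> x; apply/forallP=> y; apply/implyP=> xy; rewrite !ffunE.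
by apply: contraTneq xy => /enum_rank_inj ->; rewrite adj_irr.
Qed.

Definition chromatic_number (G : sgraph) : nat := ex_minn (colorable_exists G).

(* The library gives {vspace vT} no finType structure, even over a finite
   field; subspaces are encoded there by square matrices over F. *)
HB.instance Definition _ (F : finFieldType) (vT : vectType F) :=
  isCountable.Build {vspace vT}
    (pcan_pickleK (can_pcan (@VectorInternalTheory.vs2mxK F vT))).
HB.instance Definition _ (F : finFieldType) (vT : vectType F) :=
  isFinite.Build {vspace vT}
    (pcan_enumP (can_pcan (@VectorInternalTheory.vs2mxK F vT))).

Section SymplecticGraph.

Variables (nu : nat) (F : finFieldType).

(* The rows are (0, 1) and (-1, 0). *)
Definition hyperbolic_block : 'M[F]_2 :=
  \matrix_(i, j) ((i < j)%N%:R - (j < i)%N%:R).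

Fact symp_dimE : (\sum_(i < nu) 2 = 2 * nu)%N.
Proof. by rewrite sum_nat_const card_ord mulnC. Qed.

Definition symp_mx : 'M[F]_(2 * nu) :=
  castmx (symp_dimE, symp_dimE) (\mxdiag_(i < nu) hyperbolic_block).

Definition symp_form (a b : 'rV[F]_(2 * nu)) : F :=
  (a *m symp_mx *m b^T) 0 0.

Definition sp_vertex : finType :=
  {L : {vspace 'rV[F]_(2 * nu)} | \dim L == 1%N}.

(* Adjacency quantifies over spanning vectors; sp_adjE shows that it does not
   depend on their choice. *)
Definition sp_adj : rel sp_vertex := fun L M =>
  [exists a : 'rV[F]_(2 * nu), exists b : 'rV[F]_(2 * nu),
    [&& val L == <[a]>%VS, val M == <[b]>%VS & symp_form a b != 0]].

Lemma hyperbolic_block_tr : hyperbolic_block^T = - hyperbolic_block.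
Proof. by apply/matrixP=> i j; rewrite !mxE opprB. Qed.

Lemma symp_mx_tr : symp_mx^T = - symp_mx.
Proof.
rewrite /symp_mx trmx_cast /= tr_mxdiag.
rewrite (eq_mxdiag (fun=> hyperbolic_block_tr)) mxdiagN.
by apply/matrixP=> i j; rewrite !(castmxE, mxE).
Qed.

Lemma symp_mx_diag i : symp_mx i i = 0.
Proof.
rewrite /symp_mx castmxE /=; set k := cast_ord _ i.
by rewrite /mxdiag /mxblock !mxE eqxx conform_mx_id !mxE subrr.
Qed.

Lemma symp_form_anti a b : symp_form b a = - symp_form a b.
Proof.
rewrite /symp_form -[b *m symp_mx *m a^T]trmxK mxE !trmx_mul trmxK symp_mx_tr.
by rewrite mulNmx mulmxN mulmxA mxE.
Qed.

Lemma symp_formZ x y a b :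
  symp_form (x *: a) (y *: b) = x * y * symp_form a b.
Proof.
rewrite /symp_form; set A := a *m symp_mx *m b^T.
have -> : (x *: a) *m symp_mx *m (y *: b)^T = (x * y) *: A.
  by rewrite linearZ /= -scalemxAr -!scalemxAl scalerA mulrC.
by rewrite mxE.
Qed.

Lemma symp_form_alt a : symp_form a a = 0.
Proof.
pose t (i j : 'I_(2 * nu)) := a 0 i * symp_mx i j * a 0 j.
have tN i j : t j i = - t i j.
  rewrite /t; have /matrixP/(_ i j) := symp_mx_tr; rewrite !mxE => ->.
  by rewrite mulrN mulNr mulrAC [a 0 j * _]mulrC mulrAC.
have tD i : t i i = 0 by rewrite /t symp_mx_diag mulr0 mul0r.
have -> : symp_form a a = \sum_i \sum_j t i j.
  rewrite /symp_form mxE exchange_big; apply: eq_bigr => j _.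
  by rewrite !mxE mulr_suml; apply: eq_bigr.
have splitE (i : 'I_(2 * nu)) : \sum_j t i j =
    \sum_(j : 'I_(2 * nu) | (i < j)%N) t i j +
    \sum_(j : 'I_(2 * nu) | (j < i)%N) t i j.
  rewrite (bigID (fun j : 'I__ => (i < j)%N)) /=; congr (_ + _).
  rewrite (bigD1 i) ?ltnn //= tD add0r; apply: eq_bigl => j.
  by rewrite -leqNgt ltn_neqAle andbC.
under eq_bigr do rewrite splitE.
rewrite big_split /= [X in _ + X](exchange_big_dep xpredT) //= -big_split /=.
apply: big1 => i _; rewrite -big_split big1 // => j _ /=.
by rewrite tN addNr.
Qed.

Lemma sp_adjE (L M : sp_vertex) a b :
    val L = <[a]>%VS -> val M = <[b]>%VS ->
  sp_adj L M = (symp_form a b != 0).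
Proof.
move=> La Mb; apply/existsP/idP=> [[a' /existsP[b' /and3P[/eqP La' /eqP Mb']]]|].
  have /vlineP[x ->] : a' \in <[a]>%VS by rewrite -La La' memv_line.
  have /vlineP[y ->] : b' \in <[b]>%VS by rewrite -Mb Mb' memv_line.
  by rewrite symp_formZ; apply: contra_neq => ->; rewrite mulr0.
by move=> ab; exists a; apply/existsP; exists b; rewrite La Mb !eqxx.
Qed.

Lemma sp_vertexP (L : sp_vertex) : exists2 a, a != 0 & val L = <[a]>%VS.
Proof.
have dimL := eqP (valP L); exists (vpick (val L)).
  by rewrite vpick0 -dimv_eq0 dimL.
apply/esym/eqP; rewrite eqEdim -memvE memv_pick dimL dim_vline.
by rewrite vpick0 -dimv_eq0 dimL.
Qed.

Lemma sp_adj_sym : symmetric sp_adj.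
Proof.
move=> L M; have [[a _ La] [b _ Mb]] := (sp_vertexP L, sp_vertexP M).
by rewrite (sp_adjE La Mb) (sp_adjE Mb La) symp_form_anti oppr_eq0.
Qed.

Lemma sp_adj_irr : irreflexive sp_adj.
Proof.
move=> L; have [a _ La] := sp_vertexP L.
by rewrite (sp_adjE La La) symp_form_alt eqxx.
Qed.

Definition symplectic_graph : sgraph := SGraph sp_adj_sym sp_adj_irr.

End SymplecticGraph.

(* Main.v *)
(* A colour class spans a totally isotropic subspace, which has dimension at
   most nu, so it contains at most q^nu - 1 of the q^(2 nu) - 1 nonzero vectors;
   hence at least q^nu + 1 colours are needed.  For the converse, let L be the
   extension of F of degree nu, with basis (e_i) and a nonzero functional l, and
   send the vector with odd coordinates x and even coordinates y to the pair
   (u, w) in L^2, where u = \sum_i x_i e_i and l (w e_j) = y_j.  The symplectic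
   form becomes l (w' u - w u'), so that the slope w / u in L, or infinity when
   u = 0, is a proper colouring. *)
Require Import Defs.
From mathcomp Require Import all_boot all_order all_algebra.
From mathcomp Require Import all_fingroup all_solvable all_field.

Set Implicit Arguments.
Unset Strict Implicit.
Unset Printing Implicit Defensive.

Import GRing.Theory.

Local Open Scope ring_scope.

Lemma colorable_card (G : sgraph) (T : finType) (c : vertex G -> T) :
  (forall x y, adj x y -> c x != c y) -> colorable G #|T|.
Proof.
move=> cP; apply/existsP; exists [ffun x => enum_rank (c x)].
apply/forallP=> x; apply/forallP=> y; apply/implyP=> /cP.
by rewrite !ffunE (inj_eq enum_rank_inj).
Qed.

Section Form.
Variables (nu : nat) (F : finFieldType).
Implicit Types a b : 'rV[F]_(2 * nu).

(** The cast is inverse to the one in [symp_mx], so that a vector is cut along the same blocks as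
    the matrix. *)
Definition symp_block (i : 'I_nu) a : 'rV[F]_2 :=
  submxrow (castmx (erefl 1%N, esym (symp_dimE nu)) a) i.

Lemma symp_form_block a b :
  symp_form a b =
    \sum_i (symp_block i a *m hyperbolic_block F *m (symp_block i b)^T) 0 0.
Proof.
rewrite -summxE -mul_mxrow_mxcol -mul_mxrow_mxdiag submxrowK -tr_mxrow submxrowK.
rewrite /symp_form /symp_mx; move: (symp_dimE nu) a b => e.
by case: _ / e => a b; rewrite !castmx_id.
Qed.

Lemma symp_formE a b :
  symp_form a b = \sum_i (symp_block i a 0 0 * symp_block i b 0 1
                        - symp_block i a 0 1 * symp_block i b 0 0).
Proof.
rewrite symp_form_block; apply: eq_bigr => i _.
rewrite !mxE !big_ord_recl big_ord0 !mxE !big_ord_recl !big_ord0 !mxE /=.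
have -> : lift ord0 ord0 = 1 :> 'I_2 by apply/val_inj.
by rewrite !subrr !mulr0 !addr0 add0r subr0 sub0r mulr1 mulrN1 mulNr addrC.
Qed.

(** Each hyperbolic block squares to -1, so the inverse of K is -K. *)
Lemma symp_mx_unit : symp_mx nu F \in unitmx.
Proof.
suff K1 : symp_mx nu F *m (- symp_mx nu F) = 1%:M by case: (mulmx1_unit K1).
have HH : hyperbolic_block F *m - hyperbolic_block F = 1%:M.
  apply/matrixP=> i j; rewrite !mxE !big_ord_recl big_ord0 !mxE.
  case: i => [[|[|i]] ?] //; case: j => [[|[|j]] ?] //;
  by rewrite /= !(mulr0, mul0r, subr0, sub0r, oppr0, subrr, addr0, add0r, opprK,
                  mulrNN, mulr1).
rewrite /symp_mx; move: (symp_dimE nu) => e; case: _ / e; rewrite castmx_id.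
rewrite -mxdiagN {2}/mxdiag mul_mxdiag_mxblock -mxdiagZ -HH /mxdiag.
apply: eq_mxblock => i j; case: eqP => [ij|_]; last by rewrite mulmx0.
by case: _ / ij; rewrite !conform_mx_id.
Qed.
End Form.

(** List [A] as the rows of [M]. Then M K M^T = 0 with K invertible forces 2 rank M <= 2 nu, and [A]
    lies in the row space of [M] without 0. *)
Lemma card_isotropic (nu : nat) (F : finFieldType) (A : {set 'rV[F]_(2 * nu)}) :
  0 \notin A -> {in A &, forall a b, symp_form a b = 0} ->
  (#|A| <= #|F| ^ nu - 1)%N.
Proof.
move=> A0 A_iso; pose M := \matrix_(i < #|A|) enum_val i.
have MKM0 : M *m symp_mx nu F *m M^T = 0.
  apply/matrixP=> i j; rewrite [RHS]mxE -(A_iso _ _ (enum_valP i) (enum_valP j)).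
  rewrite -[enum_val i](rowK (fun i => enum_val i)).
  rewrite -[enum_val j](rowK (fun i => enum_val i)) /symp_form -row_mul.
  by rewrite !mxE; apply: eq_bigr => k _; rewrite !mxE.
have rM : (\rank M <= nu)%N.
  have := mulmx0_rank_max MKM0.
  rewrite mxrankMfree ?row_free_unit ?symp_mx_unit // mxrank_tr.
  by rewrite addnn -mul2n leq_pmul2l.
pose R := [set x *m row_base M | x : 'rV[F]_(\rank M)].
have sAR : A \subset R :\ 0.
  apply/subsetP=> a Aa; rewrite !inE (memPn A0) //=.
  have /submxP[x ->] : (a <= row_base M)%MS.
    rewrite eq_row_base -(enum_rankK_in Aa Aa).
    by rewrite -(rowK (fun i => enum_val i)) row_sub.
  exact: imset_f.
apply: leq_trans (subset_leq_card sAR) _.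
have R0 : 0 \in R by apply/imsetP; exists 0; rewrite ?mul0mx.
have := cardsD1 0 R; rewrite R0 => E.
rewrite leq_subRL ?expn_gt0 ?(ltnW (finNzRing_gt1 F)) //.
(* The summand 1 accounts for the zero vector of [R]. *)
rewrite -[X in (X + _)%N]/(nat_of_bool true) -E (leq_trans (leq_imset_card _ _)) //.
by rewrite card_mx mul1n leq_exp2l ?finNzRing_gt1.
Qed.

Lemma colorable_symplectic_geq (nu : nat) (F : finFieldType) k :
  (0 < nu)%N ->
  colorable (symplectic_graph nu F) k -> (#|F| ^ nu + 1 <= k)%N.
Proof.
move=> nu_gt0 /existsP[c /forallP cP].
(* The zero vector is in no [A i], since its span has dimension 0. *)
pose A i := [set a : 'rV[F]_(2 * nu) |
  [exists L : sp_vertex nu F, (val L == <[a]>%VS) && (c L == i)]].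
have cardA i : (#|A i| <= #|F| ^ nu - 1)%N.
  apply: card_isotropic => //.
    rewrite inE; apply/existsP=> -[L /andP[/eqP L0 _]].
    by have := valP L; rewrite /= L0 dim_vline eqxx.
  move=> a b; rewrite !inE => /existsP[L /andP[/eqP La /eqP Li]].
  move=> /existsP[M /andP[/eqP Mb /eqP Mi]]; apply/eqP/negPn.
  rewrite -(sp_adjE La Mb); apply/negP=> LM.
  by have /forallP/(_ M)/implyP/(_ LM) := cP L; rewrite Li Mi eqxx.
have cover : [set~ 0] \subset \bigcup_i A i.
  apply/subsetP=> a; rewrite !inE => nz_a.
  have dim_a : \dim <[a]> == 1%N by rewrite dim_vline nz_a.
  apply/bigcupP; exists (c (Sub <[a]>%VS dim_a)) => //.
  by rewrite inE; apply/existsP; exists (Sub <[a]>%VS dim_a); rewrite !eqxx.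
have q_gt1 := finNzRing_gt1 F.
have leV : (#|F| ^ (2 * nu) - 1 <= k * (#|F| ^ nu - 1))%N.
  have := subset_leq_card cover.
  rewrite cardsC1 card_mx mul1n -subn1 => /leq_trans; apply.
  have leU : (#|\bigcup_i A i| <= \sum_i #|A i|)%N.
    elim/big_rec2: _ => [|i m B _ leB]; first by rewrite cards0.
    by rewrite (leq_trans (leq_card_setU _ _)) // leq_add2l.
  apply: leq_trans leU _.
  have -> : (k * (#|F| ^ nu - 1) = \sum_(i < k) (#|F| ^ nu - 1))%N.
    by rewrite sum_nat_const card_ord.
  exact: leq_sum.
have sqE : (#|F| ^ (2 * nu) - 1 = (#|F| ^ nu - 1) * (#|F| ^ nu + 1))%N.
  by rewrite -subn_sqr exp1n -expnM mulnC.
by rewrite sqE mulnC leq_pmul2r // subn_gt0 -(exp1n nu) ltn_exp2r in leV.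
Qed.

(* L is a splitting field of X^N - X over F, with N = #|F|^n.  Its roots are the
   fixed points of the n-th power of the Frobenius, so they form a subfield. *)
Lemma exists_fieldExt_dim (F : finFieldType) n :
  (0 < n)%N -> exists L : splittingFieldType F, \dim {:L} = n.
Proof.
move=> n_gt0; pose N := (#|F| ^ n)%N.
have q_gt1 := finNzRing_gt1 F.
have N_gt1 : (1 < N)%N by rewrite -(exp1n n) ltn_exp2r.
pose P (R : nzRingType) : {poly R} := 'X^N - 'X.
have sizeP (R : nzRingType) : size (P R) = N.+1.
  by rewrite size_polyDl size_polyXn // size_polyN size_polyX ltnS.
have /FinSplittingFieldFor[L /= splitP] : P F != 0.
  by rewrite -size_poly_eq0 sizeP.
exists L; pose finL := FinFieldExtType L.
rewrite [map_poly _ _]rmorphB rmorphXn /= map_polyX -/(P L) in splitP.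
have [zs DP genL] := splitP.
(* The generator [a] over F is the Frobenius map x -> x^q with q = #|F|. *)
have [a _ Da] := finField_galois_generator (sub1v {:L}).
rewrite /= dimv1 expn1 in Da.
have DaX x : (a ^+ n)%g x = x ^+ N.
  rewrite /N; elim: (n) => [|m IHm]; first by rewrite gal_id.
  by rewrite expgSr galM ?memvf // IHm Da ?memvf // expnSr exprM.
have PE (x : L) : root (P L) x = (x ^+ N == x).
  by rewrite rootE !hornerE subr_eq0.
have fixL (x : L) : x ^+ N = x.
  suff : x \in fixedSpace (a ^+ n)%g by move/fixedSpaceP; rewrite DaX.
  suff : (<<1 & zs>> <= fixedSpace (a ^+ n)%g)%VS.
    by rewrite genL => /subvP; apply; rewrite memvf.
  rewrite -[fixedSpace _]subfield_closed agenvS // subv_add sub1v.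
  apply/span_subvP=> z zs_z; apply/fixedSpaceP; rewrite DaX; apply/eqP.
  by rewrite -PE (eqp_root DP) root_prod_XsubC.
(* The derivative of X^N - X is the constant -1, because q, and hence N, vanishes in F. *)
have sepP : separable_poly (P L).
  rewrite separable_poly.unlock derivB derivXn derivX.
  have -> : ('X^(N.-1) : {poly L}) *+ N = 0.
    have q0 : #|F|%:R = 0 :> F.
      (* The additive order of 1 divides the order of the group F. *)
      by apply/eqP; rewrite -FinRing.zmodXgE -order_dvdn -cardsT order_dvdG ?inE.
    rewrite -scaler_nat -(rmorph_nat (in_alg L)) natrX q0 expr0n gtn_eqF //.
    by rewrite rmorph0 scale0r.
  by rewrite sub0r -scaleN1r coprimepZr ?coprimep1 // oppr_eq0 oner_eq0.
(* At most N, as every element is a root of [P L]; at least N, as separability makes the N roots in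
   [zs] distinct. *)
have cardL : #|finL| = N.
  apply/eqP; rewrite eqn_leq; apply/andP; split.
    rewrite cardE -ltnS -(sizeP L); apply: max_poly_roots.
    - by rewrite -size_poly_eq0 sizeP.
    - by apply/allP=> x _; rewrite PE; apply/eqP/(fixL x).
    - exact: enum_uniq.
  rewrite -ltnS -(sizeP L) (eqp_size DP) size_prod_XsubC ltnS.
  have /card_uniqP <- : uniq (zs : seq finL).
    by rewrite -(separable_prod_XsubC zs) -(eqp_separable DP).
  exact: max_card.
apply/eqP; rewrite -(eqn_exp2l _ _ q_gt1) -/N -cardL.
by rewrite -(@card_vspacef F finL (Vector.class L)) card_vspace.
Qed.

(** For a nonzero functional [l], the bilinear form l(xy) on L is nondegenerate, so its Gram matrix
    [T] on [e] is invertible; [g] solves for the coefficients through the inverse of [T]. *)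
Lemma exists_scalar_dual_basis (F : fieldType) (L : fieldExtType F) n
    (e : n.-tuple L) : (0 < n)%N -> basis_of {:L} e ->
  exists (l : {scalar L}) (g : 'rV[F]_n -> L),
    forall w j, l (g w * e`_(val j)) = w 0 j.
Proof.
case: n e => // n e _ e_basis; have e_free := basis_free e_basis.
pose l : {scalar L} := coord e ord0.
pose comb (x : 'rV[F]_n.+1) := \sum_i x 0 i *: e`_i.
pose T := \matrix_(i < n.+1, j < n.+1) l (e`_(val i) * e`_(val j)).
have TE x (j : 'I_n.+1) : l (comb x * e`_(val j)) = (x *m T) 0 j.
  rewrite mxE mulr_suml linear_sum; apply: eq_bigr => i _.
  by rewrite -scalerAl linearZ mxE.
have T_unit : T \in unitmx.
  rewrite -row_free_unit -kermx_eq0; apply/rowV0P=> x /sub_kermxP xT0.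
  have l0 y : l (comb x * y) = 0.
    rewrite (coord_basis e_basis (memvf y)) mulr_sumr linear_sum big1 // => j _.
    by rewrite -scalerAr linearZ TE xT0 mxE /= mulr0.
  have : comb x = 0.
    (* This multiplier turns [comb x] into e_0, where [l] takes the value 1. *)
    apply/eqP; apply: contraT => nz_x; have := l0 ((comb x)^-1 * e`_0).
    rewrite mulrA divff // mul1r /l /= (coord_free ord0 ord0 e_free) eqxx => /eqP.
    by rewrite oner_eq0.
  by move/(freeP e_free) => x0; apply/rowP=> i; rewrite mxE x0.
exists l, (fun w => comb (w *m invmx T)) => w j.
by rewrite TE mulmxKV.
Qed.

Lemma colorable_symplectic (nu : nat) (F : finFieldType) :
  (0 < nu)%N -> colorable (symplectic_graph nu F) (#|F| ^ nu + 1)%N.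
Proof.
move=> nu_gt0; have [L dimL] := exists_fieldExt_dim F nu_gt0.
have [e e_basis] : exists e : nu.-tuple L, basis_of {:L} e.
  by case: nu / dimL {nu_gt0}; exists (vbasis {:L}); exact: vbasisP.
have [l [g lg]] := exists_scalar_dual_basis nu_gt0 e_basis.
pose u (a : 'rV[F]_(2 * nu)) := \sum_i symp_block i a 0 0 *: e`_(val i).
pose w (a : 'rV[F]_(2 * nu)) := g (\row_i symp_block i a 0 1).
(* Expanding [u a] in the basis, the choice of [g] makes l (w b * e_i) the second coordinate of
   block i of [b]. *)
have formE a b : symp_form a b = l (w b * u a - w a * u b).
  rewrite symp_formE linearB !mulr_sumr !linear_sum -sumrB.
  apply: eq_bigr => i _; rewrite -!scalerAr !linearZ /= !lg !mxE.
  by rewrite [X in _ - X]mulrC.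
(* [None] is the slope infinity; it keeps the convention w / 0 = 0 from merging it with slope 0. *)
pose color a : option (finvect_type L) :=
  if u a == 0 then None else Some (w a / u a).
have colorP a b : color a = color b -> symp_form a b = 0.
  rewrite formE /color; case: eqP => [-> | /eqP nz_a];
    case: eqP => [-> | /eqP nz_b] //.
    by rewrite !mulr0 subrr linear0.
  case=> /eqP; rewrite (eqr_div _ _ nz_a nz_b) => /eqP->.
  by rewrite subrr linear0.
have cardL : #|{: option (finvect_type L)}| = (#|F| ^ nu + 1)%N.
  rewrite card_option -dimL addn1.
  by rewrite -(@card_vspacef F (finvect_type L) (Vector.class L)) card_vspace.
rewrite -cardL.
(* A vertex gets the colour of one chosen spanning vector, on which adjacency can be tested by
   [sp_adjE]. *)
pose span_vec (x : sp_vertex nu F) := s2val (sig2_eqW (sp_vertexP x)).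
have span_vecP x : val x = <[span_vec x]>%VS by rewrite /span_vec; case: sig2_eqW.
apply: (@colorable_card (symplectic_graph nu F) _ (color \o span_vec)).
move=> x y; rewrite /= (sp_adjE (span_vecP x) (span_vecP y)).
by apply: contra_neq => /colorP.
Qed.

Theorem theorem2p4 (q nu : nat) (F : finFieldType) (hF : #|F| = q)
    (hnu : (1 <= nu)%N) :
  chromatic_number (symplectic_graph nu F) = (q ^ nu + 1)%N.
Proof.
rewrite -hF /chromatic_number; case: ex_minnP => k k_col k_min.
apply/eqP; rewrite eqn_leq k_min ?colorable_symplectic //.
exact: colorable_symplectic_geq.
Qed.
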